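(* Consider the optimal control problem of the context, and suppose that $(x,u)\mapsto\mathcal{H}(x,u,t,\psi,1)$ is linear in $(x,u)$ for each $\psi$ and $t$. Let $(\hat u(\cdot),\hat x(\cdot))$ be an admissible pair, with associated function $\hat J_x(t,T)$ defined in the context. Then: 1) $(\hat u(\cdot),\hat x(\cdot))$ is overtaking optimal if and only if for each admissible control $u(\cdot)$ $$\liminf_{T\to\infty}\int_{t_0}^{T}\left\langle\frac{\partial \mathcal{H}}{\partial u}(\hat x(t),\hat u(t),t,\hat J_x(t,T),1),\ \hat u(t)-u(t)\right\rangle dt\ \ge\ 0;$$ 2) $(\hat u(\cdot),\hat x(\cdot))$ is weakly overtaking optimal if and only if for each admissible control $u(\cdot)$ $$\limsup_{T\to\infty}\int_{t_0}^{T}\left\langle\frac{\partial \mathcal{H}}{\partial u}(\hat x(t),\hat u(t),t,\hat J_x(t,T),1),\ \hat u(t)-u(t)\right\rangle dt\ \ge\ 0.$$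
   Context: Setting. $X\subseteq\mathbb{R}^n$ is nonempty, open and convex; $U\subseteq\mathbb{R}^m$ is an arbitrary nonempty set. The problem is to maximize $\int_{t_0}^{\infty} g(x(t),u(t),t)\,dt$ over controls $u(\cdot)$ subject to $\dot x(t)=f(x(t),u(t),t)$, $x(t_0)=x_0$, where $u(t)\in U$ and the state $x(t)\in X$ exists for all $t\in[t_0,+\infty)$. Such $u(\cdot)$ and $x(\cdot)$ are called admissible (an admissible control, with its trajectory; together an admissible pair). The functions $f$ (with values in $\mathbb{R}^n$) and $g$ (real-valued) are differentiable with respect to $(x,u)$ and, together with these partial derivatives, are defined and locally bounded, measurable in $t$ for every $(x,u)\in X\times U$, and continuous in $(x,u)$ for almost every $t\in[0,\infty)$. The improper integral need not converge. Optimality. For an admissible control $u(\cdot)$ with trajectory $x(\cdot)$ put $J(u(\cdot),x_0,t_0,T)=\int_{t_0}^{T}g(x(t),u(t),t)\,dt$. An admissible control $\hat u(\cdot)$ (or the pair $(\hat u(\cdot),\hat x(\cdot))$) is overtaking optimal if for every admissible $u(\cdot)$ and every $\varepsilon>0$ there is $T=T(\varepsilon,u(\cdot))>t_0$ such that for all $T'\ge T$, $J(u(\cdot),x_0,t_0,T')-J(\hat u(\cdot),x_0,t_0,T')\le\varepsilon$. It is weakly overtaking optimal if for every admissible $u(\cdot)$, every $\varepsilon>0$ and every $T>t_0$ there is $T'=T'(\varepsilon,T,u(\cdot))\ge T$ such that $J(u(\cdot),x_0,t_0,T')-J(\hat u(\cdot),x_0,t_0,T')\le\varepsilon$. Hamilton–Pontryagin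 function: $\mathcal{H}(x,u,t,\psi,\lambda)=\lambda\,g(x,u,t)+\langle\psi,f(x,u,t)\rangle$, with $\lambda\in\mathbb{R}$, $\psi\in\mathbb{R}^n$, and $\langle\cdot,\cdot\rangle$ the scalar product. The function $\hat J_x$: for the pair $(\hat u(\cdot),\hat x(\cdot))$, $$\hat J_x(t,T)=Y(t)^{-1}\int_t^T Y(s)\,\frac{\partial g}{\partial x}(\hat x(s),\hat u(s),s)\,ds\in\mathbb{R}^n,$$ where $\partial g/\partial x$ is a column vector and $Y(t)$ is an invertible $n\times n$ matrix function with $\dot Y(t)=Y(t)\left(\frac{\partial f}{\partial x}(\hat x(t),\hat u(t),t)\right)'$. Here $\frac{\partial f}{\partial x}$ is the Jacobian matrix and $'$ denotes transpose. Thus $t\mapsto\hat J_x(t,T)$ is the solution of the adjoint equation $-\dot\psi(t)=\frac{\partial\mathcal{H}}{\partial x}(\hat x(t),\hat u(t),t,\psi(t),1)$ with $\psi(T)=0$. *)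

(* Defs.v *)
From HB Require Import structures.
From mathcomp Require Import all_boot all_order all_algebra.
From mathcomp Require Import all_classical all_reals all_analysis.
Set Implicit Arguments.
Unset Strict Implicit.
Unset Printing Implicit Defensive.
Import Order.TTheory GRing.Theory Num.Theory.
Import numFieldNormedType.Exports.
Local Open Scope classical_set_scope.
Local Open Scope ring_scope.

(* Measurability and integrals are in the sense of Lebesgue: [lebR R] is R with
   the Lebesgue sigma-algebra (not only the Borel one). *)
Notation leb R := (@completed_lebesgue_measure R).
Notation lebR R := (caratheodory_type (@wlength R idfun)^*%mu).

Section Calculus.
Context {R : realType}.

Definition dotp {k} (v w : 'cV[R]_k) : R := \sum_(i < k) v i 0 * w i 0.

Definition grad {k} (h : 'cV[R]_k -> R) (x : 'cV[R]_k) : 'cV[R]_k :=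
  \col_(j < k) 'D_(delta_mx j 0) h x.

(* The library's ['J] acts on row vectors and is the transpose of this one. *)
Definition jac {k l} (h : 'cV[R]_k -> 'cV[R]_l) (x : 'cV[R]_k) : 'M[R]_(l, k) :=
  \matrix_(i < l, j < k) 'D_(delta_mx j 0) (fun y => h y i 0) x.

Definition loc_integrable (t0 : R) (h : R -> R) :=
  forall T : R, t0 <= T -> (leb R).-integrable `[t0, T] (EFin \o h).

(* y' = h almost everywhere on [t0, +oo[ with y locally absolutely continuous
   (solution in the sense of Caratheodory), in integral form. *)
Definition caratheodory_solution {p q} (t0 : R) (y h : R -> 'M[R]_(p, q)) :=
  forall i j, loc_integrable t0 (fun t => h t i j) /\
    forall t : R, t0 <= t ->
      y t i j = y t0 i j + \int[leb R]_(s in `[t0, t]) h s i j.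

End Calculus.

(* The maps are total, but only their values for x in X, u in a neighbourhood
   of U and t >= 0 matter; the neighbourhood is what gives a meaning to
   derivatives in u when U is an arbitrary set. *)
Record control_problem (R : realType) (n m : nat) := ControlProblem {
  stateset : set 'cV[R]_n ;
  ctrlset : set 'cV[R]_m ;
  dyn : 'cV[R]_n -> 'cV[R]_m -> R -> 'cV[R]_n ;
  gain : 'cV[R]_n -> 'cV[R]_m -> R -> R ;
  initime : R ;
  inistate : 'cV[R]_n }.

Section ControlProblem.
Context {R : realType} {n m : nat} (P : control_problem R n m).

Let X := stateset P.
Let U := ctrlset P.
Let f := dyn P.
Let g := gain P.
Let t0 := initime P.
Let x0 := inistate P.

Definition regular_data (h : 'cV[R]_n -> 'cV[R]_m -> R -> R) :=
  [/\ [locally [bounded h z.1.1 z.1.2 z.2 | z in X `*` U `*` `[0, +oo[]],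
      forall x u, X x -> U u ->
        measurable_fun (`[0, +oo[%classic : set (lebR R)) (h x u) &
      {ae leb R, forall t : R, 0 <= t ->
        {within X `*` U, continuous (fun z => h z.1 z.2 t)}}].

Definition standing_assumptions :=
  [/\ [/\ X !=set0, open X & convex_set X], U !=set0, 0 <= t0,
      forall t x u, 0 <= t -> X x -> U u ->
        differentiable (fun z => f z.1 z.2 t) (x, u) /\
        differentiable (fun z => g z.1 z.2 t) (x, u) &
      [/\ forall i, regular_data (fun x u t => f x u t i 0),
          forall i j, regular_data (fun x u t => jac (fun y => f y u t) x i j),
          forall i j, regular_data (fun x u t => jac (fun v => f x v t) u i j),
          regular_data g &
          (forall i, regular_data (fun x u t => grad (fun y => g y u t) x i 0)) /\
          (forall i, regular_data (fun x u t => grad (fun v => g x v t) u i 0))]].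

(* Integrability of the gain along the pair is what makes J well defined. *)
Definition admissible_pair (u : R -> 'cV[R]_m) (x : R -> 'cV[R]_n) :=
  [/\ forall i, measurable_fun (`[t0, +oo[%classic : set (lebR R))
                  (fun t => u t i 0),
      forall t : R, t0 <= t -> U (u t) /\ X (x t),
      x t0 = x0,
      caratheodory_solution t0 x (fun t => f (x t) (u t) t) &
      loc_integrable t0 (fun t => g (x t) (u t) t)].

Definition admissible_control (u : R -> 'cV[R]_m) :=
  exists x, admissible_pair u x.

Definition J (u : R -> 'cV[R]_m) (x : R -> 'cV[R]_n) (T : R) : R :=
  \int[leb R]_(t in `[t0, T]) g (x t) (u t) t.

Definition overtaking_optimal (uh : R -> 'cV[R]_m)
    (xh : R -> 'cV[R]_n) :=
  admissible_pair uh xh /\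
  forall u x, admissible_pair u x -> forall e : R, 0 < e ->
    exists2 T : R, t0 < T &
      forall T' : R, T <= T' -> J u x T' - J uh xh T' <= e.

Definition weakly_overtaking_optimal (uh : R -> 'cV[R]_m)
    (xh : R -> 'cV[R]_n) :=
  admissible_pair uh xh /\
  forall u x, admissible_pair u x -> forall e : R, 0 < e ->
    forall T : R, t0 < T ->
      exists2 T' : R, T <= T' & J u x T' - J uh xh T' <= e.

Definition hamiltonian (x : 'cV[R]_n) (u : 'cV[R]_m) (t : R) (psi : 'cV[R]_n)
    (lambda : R) : R :=
  lambda * g x u t + dotp psi (f x u t).

(* "Linear" allows a constant term, as usual for functions on a convex set that
   need not contain 0. The identity is required near, not only on, X x U:
   otherwise the values of H would not determine its derivative in u. *)
Definition linear_hamiltonian :=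
  forall (t : R) (psi : 'cV[R]_n), 0 <= t ->
    exists (L : {linear ('cV[R]_n * 'cV[R]_m)%type -> R^o}) (c : R),
      forall x u, X x -> U u ->
        \forall z \near (x, u), hamiltonian z.1 z.2 t psi 1 = L z + c.

Definition fundamental_matrix (uh : R -> 'cV[R]_m)
    (xh : R -> 'cV[R]_n) (Y : R -> 'M[R]_n) :=
  (forall t : R, t0 <= t -> Y t \in unitmx) /\
  caratheodory_solution t0 Y
    (fun t => Y t *m (jac (fun y => f y (uh t) t) (xh t))^T).

Definition Jhat_x (uh : R -> 'cV[R]_m) (xh : R -> 'cV[R]_n)
    (Y : R -> 'M[R]_n) (t T : R) : 'cV[R]_n :=
  invmx (Y t) *m
  \col_(i < n) \int[leb R]_(s in `[t, T])
    (Y s *m grad (fun y => g y (uh s) s) (xh s)) i 0.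

(* The integral whose lower and upper limits as T --> +oo are considered. *)
Definition first_variation (uh : R -> 'cV[R]_m) (xh : R -> 'cV[R]_n)
    (Y : R -> 'M[R]_n) (u : R -> 'cV[R]_m) (T : R) : R :=
  \int[leb R]_(t in `[t0, T])
    dotp (grad (fun v => hamiltonian (xh t) v t (Jhat_x uh xh Y t T) 1) (uh t))
         (uh t - u t).

End ControlProblem.

(* Main.v *)
Require Import Defs.
From HB Require Import structures.
From mathcomp Require Import all_boot all_order all_algebra.
From mathcomp Require Import all_classical all_reals all_analysis.
From mathcomp Require Import measurable_realfun lra ring.
Import Order.TTheory GRing.Theory Num.Theory.
Import numFieldNormedType.Exports.
Set Implicit Arguments.
Unset Strict Implicit.
Unset Printing Implicit Defensive.
Local Open Scope classical_set_scope.
Local Open Scope ring_scope.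

(** Both equivalences reduce to one identity: for every admissible pair (u, x)
    and every T >= t0, the first variation at u over [t0, T] equals
    J(uh, xh, T) - J(u, x, T) exactly ([first_variationE]).  With it, the two
    notions of optimality are the epsilon-forms of the nonnegativity of the
    lower and the upper limit ([limf_einf_ge0], [limf_esup_ge0]).

    The identity comes from linearity.  Write D = x - xh and psi(t) for the
    adjoint Jhat_x(t, T) = Z(t) p(t), with Z = Y^-1 and p(t) the integral of
    Y dg/dx over [t, T].  As H(., ., t, psi(t), 1) is affine with the same
    linear part everywhere, its increment from (xh, uh) to (x, u) is the sum of
    its two partial differentials, without remainder
    ([hamiltonian_increment]).  Hence
    <dH/du, uh - u> = (g along (xh, uh) - g along (x, u)) - q, where
    q = <psi, D'> - <dg/dx + (df/dx)^T psi, D> is the derivative of <psi, D>,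
    because psi' = - dg/dx - (df/dx)^T psi.  The integral of q over [t0, T]
    vanishes since D(t0) = 0 and psi(T) = 0.

    The analytic content is that <psi, D>, which contains the inverse matrix Z,
    is the indefinite integral of q although the data are only measurable in
    time.  It rests on one lemma, [increment_primitive]: if the increment of F
    between s and t is a finite sum of terms A(t) B(s) int_s^t C with A and B
    continuous and C integrable, then F is an indefinite integral of
    sum A B C.  It gives the product rule ([primitive_mxM]) and, through
    Z(t) - Z(s) = - Z(t) (Y(t) - Y(s)) Z(s), the derivative of the inverse
    matrix ([primitive_invmx]). *)
(** * Lebesgue integrals over intervals *)

Section LebesgueInterval.
Context {R : realType}.
Implicit Types (a b r s t x y : R) (f g : R -> R).

Lemma measurable_lebR (A : set (measurableTypeR R)) :
  measurable A -> measurable (A : set (lebR R)).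
Proof. exact: sub_caratheodory. Qed.

Lemma measurable_lebR_itv (i : interval R) : measurable ([set` i] : set (lebR R)).
Proof. by apply: measurable_lebR; exact: measurable_itv. Qed.

Lemma leb_itv (i : interval R) : leb R [set` i] =
  (if (i.1 < i.2)%E then ((i.2 : \bar R) - i.1)%E else 0).
Proof. exact: lebesgue_measure_itv. Qed.

Lemma integrable_subitv (i j : interval R) f : [set` i] `<=` [set` j] ->
  (leb R).-integrable [set` j] (EFin \o f) ->
  (leb R).-integrable [set` i] (EFin \o f).
Proof. by move=> ij; apply: integrableS => //; exact: measurable_lebR_itv. Qed.

Lemma eq_integrable_itv (i : interval R) f g :
  (forall t, t \in i -> f t = g t) ->
  (leb R).-integrable [set` i] (EFin \o f) ->
  (leb R).-integrable [set` i] (EFin \o g).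
Proof.
move=> fg; apply: eq_integrable; first exact: measurable_lebR_itv.
by move=> t /set_mem/= /fg fgt; rewrite /= fgt.
Qed.

Lemma Rintegral_itv_split (u : itv_bound R) s t f :
  (u <= BRight s)%O -> s <= t ->
  (leb R).-integrable [set` Interval u (BRight t)] (EFin \o f) ->
  \int[leb R]_(r in [set` Interval u (BRight t)]) f r =
  \int[leb R]_(r in [set` Interval u (BRight s)]) f r + \int[leb R]_(r in `]s, t]) f r.
Proof.
move=> us st intf.
have E := @itv_bndbnd_setU _ R u (BRight s) (BRight t) us.
rewrite E ?bnd_simp// in intf *.
rewrite Rintegral_setU//; try exact: measurable_lebR_itv.
apply/disj_setPS => z [/=]; rewrite !in_itv/= => /andP[_ zs] /andP[].
by rewrite ltNge zs.
Qed.

Lemma Rintegral_itv_cc_oc s t f : s <= t ->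
  (leb R).-integrable `[s, t] (EFin \o f) ->
  \int[leb R]_(r in `[s, t]) f r = \int[leb R]_(r in `]s, t]) f r.
Proof.
move=> st intf.
rewrite (Rintegral_itv_split (u := BLeft s) (s := s))// ?bnd_simp//.
rewrite /Rintegral null_set_integral ?add0r//; first exact: measurable_lebR_itv.
- apply: (measurable_int (leb R)).
  by apply: integrable_subitv intf; apply: subset_itvl; rewrite bnd_simp.
- by rewrite [LHS](leb_itv `[s, s])/= ltxx.
Qed.

Lemma continuous_leb_measurable a b f : {within `[a, b], continuous f} ->
  measurable_fun (`[a, b]%classic : set (lebR R)) f.
Proof.
move=> cf mD B mB.
apply: measurable_lebR.
by have := subspace_continuous_measurable_fun (measurable_itv _) cf (measurable_itv _) mB.
Qed.

Lemma continuous_itv_bounded a b f : {within `[a, b], continuous f} ->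
  [bounded f t | t in `[a, b]].
Proof.
move=> cf; have /compact_bounded := continuous_compact cf (@segment_compact _ a b).
by move=> [M [Mr h]]; exists M; split => // z /h hz t tab; apply: hz; exists t.
Qed.

Lemma integrable_continuousM a b f g : {within `[a, b], continuous f} ->
  (leb R).-integrable `[a, b] (EFin \o g) ->
  (leb R).-integrable `[a, b] (EFin \o (fun t => f t * g t)).
Proof.
move=> cf ig.
have /= := @integrableMr _ (lebR R) R (leb R) _ (measurable_lebR_itv _) f (EFin \o g)
  (continuous_leb_measurable cf) (continuous_itv_bounded cf) ig.
by apply: eq_integrable; first exact: measurable_lebR_itv.
Qed.

End LebesgueInterval.

(** * Local-to-global arguments on a segment *)

(** The supremum of the t such that P a t holds cannot lie strictly below b:
    the local property at that supremum would extend P beyond it.  The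
    compactness of [a, b] enters only through this lemma. *)
Lemma interval_induction (R : realType) (P : R -> R -> Prop) (a b : R) : a <= b ->
  (forall r s t, a <= r -> r <= s -> s <= t -> t <= b -> P r s -> P s t -> P r t) ->
  (forall r, a <= r <= b -> \forall d \near (0 : R)^'+,
     forall s t, a <= s -> r - d < s -> s <= t -> t < r + d -> t <= b -> P s t) ->
  P a b.
Proof.
move=> ab trP locP.
have loc r : a <= r <= b -> exists2 d, 0 < d & forall s t,
    a <= s -> r - d < s -> s <= t -> t < r + d -> t <= b -> P s t.
  move=> /locP h; near (0:R)^'+ => d; exists d; first by near: d; exact: nbhs_right_gt.
  by near: d; exact: h.
pose S := [set t | a <= t <= b /\ P a t].
have Sa : S a.
  split; first by rewrite lexx.
  have [|d d0 h] := loc a; first by rewrite lexx.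
  by apply: h => //; lra.
have supS : has_sup S.
  by split; [exists a | exists b => t [/andP[]]].
pose c := sup S.
have ac : a <= c by apply: sup_upper_bound.
have cb : c <= b by apply: ge_sup => [|t [/andP[]]//]; exists a.
have [|d d0 h] := loc c; first by rewrite ac.
have [t [/andP[a_t tb] Pt] ct] := sup_adherent d0 supS.
have tc : t <= c by apply: sup_upper_bound => //; split; first by rewrite a_t.
have [e [[ce eb ed] ecd]] :
    exists e, [/\ c <= e, e <= b & (e = b) \/ c < e] /\ e < c + d.
  have [bcd|bcd] := ltP b (c + d); first by exists b; split => //; split=> //; left.
  by exists (c + d / 2); split; [split; [lra|lra|right; lra] | lra].
have Pe : P a e by apply: (trP a t e) => //; [lra|apply: h => //; lra].
case: ed => [<-//|/lt_geF]; rewrite sup_upper_bound//.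
by split => //; rewrite eb; lra.
Unshelve. all: by end_near. Qed.

(** * Indefinite integrals *)

Section Primitives.
Context {R : realType}.
Implicit Types (a b r s t x y : R) (f g F G : R -> R).

(** F is absolutely continuous with derivative f almost everywhere.  The form
    with increments over ]s, t] makes additivity in (s, t) immediate and
    singles out no base point. *)
Definition primitive_on a b F f :=
  (leb R).-integrable `[a, b] (EFin \o f) /\
  forall s t, a <= s -> s <= t -> t <= b ->
    F t - F s = \int[leb R]_(r in `]s, t]) f r.

Lemma primitive_onP a b F f : (leb R).-integrable `[a, b] (EFin \o f) ->
  (forall t, a <= t <= b -> F t = F a + \int[leb R]_(r in `[a, t]) f r) ->
  primitive_on a b F f.
Proof.
move=> intf Ff; split => // s t sa st tb.
rewrite (Ff t) ?(Ff s) ?sa ?(le_trans sa)//=; last exact: le_trans tb.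
rewrite (@Rintegral_itv_split _ (BLeft a) s t)// ?bnd_simp//; first by ring.
by apply: integrable_subitv intf; apply: subset_itvl; rewrite bnd_simp.
Qed.

(** The integral of |f| over a set is small when the measure of the set is. *)
Lemma primitive_on_continuous a b F f : primitive_on a b F f ->
  {within `[a, b], continuous F}.
Proof.
move=> [intf Ff].
pose fab := f \_ `[a, b].
have intfab : (leb R).-integrable setT (EFin \o fab).
  rewrite -restrict_EFin; apply/integrable_restrict => //=.
    exact: measurable_lebR_itv.
  by rewrite setTI.
have incr e : 0 < e -> exists2 d, 0 < d & forall s t, a <= s -> s <= t -> t <= b ->
    t - s < d -> `|F t - F s| < e.
  move=> /(integral_normr_continuous intfab)[d [d0 h]]; exists d => // s t sa st tb std.
  have sub : `]s, t] `<=` `[a, b].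
    by apply: subset_itv; rewrite bnd_simp.
  rewrite Ff//; apply: le_lt_trans (h _ (measurable_lebR_itv `]s, t]) _); last first.
    rewrite [ltLHS](leb_itv `]s, t])/= lte_fin.
    by case: ifPn => // _; rewrite -EFinD lte_fin.
  rewrite [leRHS](_ : _ = \int[leb R]_(r in `]s, t]) `|f r|); last first.
    by apply: eq_Rintegral => r /set_mem/sub rab; rewrite /fab patchE mem_set.
  apply: le_normr_Rintegral; first exact: measurable_lebR_itv.
  exact: integrable_subitv intf.
apply/subspace_continuousP => r /=; rewrite in_itv/= => /andP[ar rb].
apply/cvgrPdist_lt => e /incr[d d0 h].
rewrite near_withinE; near=> t; rewrite /= in_itv/= => /andP[a_t tb].
have rt : `|r - t| < d by near: t; exact: (@cvgr_dist_lt _ R _ _ _ id r).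
have [le_rt|/ltW le_tr] := leP r t.
  by rewrite distrC h//; move: rt; rewrite ltr_norml; lra.
by rewrite h//; move: rt; rewrite ltr_norml; lra.
Unshelve. all: by end_near. Qed.

Lemma eq_primitive_on a b (F f g : R -> R) : {in `[a, b], f =1 g} ->
  primitive_on a b F f -> primitive_on a b F g.
Proof.
move=> fg [intf Ff]; split; first exact: eq_integrable_itv intf.
move=> s t sa st tb; rewrite Ff//; apply: eq_Rintegral => r.
rewrite inE/= => rst; apply: fg.
by apply: subset_itv rst; rewrite bnd_simp.
Qed.

Lemma primitive_on_tail s t f : (leb R).-integrable `[s, t] (EFin \o f) ->
  primitive_on s t (fun r => \int[leb R]_(w in `[r, t]) f w) (\- f).
Proof.
move=> intf.
have sub x y : s <= x -> y <= t -> `[x, y] `<=` `[s, t].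
  by move=> sx yt; apply: subset_itv; rewrite bnd_simp.
split.
  by apply: eq_integrable_itv (integrableN intf) => r _.
move=> x y sx xy yt.
have xt := le_trans xy yt; have sy := le_trans sx xy.
rewrite !Rintegral_itv_cc_oc//; last 2 first.
- by apply: integrable_subitv intf; exact: sub.
- by apply: integrable_subitv intf; exact: sub.
have oc z : s <= z -> `]z, t] `<=` `[s, t].
  by move=> sz; apply: subset_itv; rewrite bnd_simp.
rewrite (@Rintegral_itv_split _ (BRight x) y t)// ?bnd_simp//; last first.
  exact: integrable_subitv (oc _ sx) intf.
have -> : \int[leb R]_(r in `]x, y]) (\- f) r = -1 * \int[leb R]_(r in `]x, y]) f r.
  rewrite -RintegralZl; last 2 first.
  - exact: measurable_lebR_itv.
  - by apply: integrable_subitv intf; apply: subset_itv; rewrite bnd_simp.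
  by apply: eq_Rintegral => r _; rewrite mulN1r.
ring.
Qed.

End Primitives.

(** Joint continuity at the diagonal point (r, r) of (t, s) |-> F t * G s. *)
Lemma near_within_mul_le (R : realType) (a b r e : R) (F G : R -> R) :
  {within `[a, b], continuous F} -> {within `[a, b], continuous G} ->
  a <= r <= b -> 0 < e ->
  \forall d \near (0 : R)^'+, forall s t, a <= s <= b -> a <= t <= b ->
    r - d < s < r + d -> r - d < t < r + d ->
    `|F t * G s - F r * G r| <= e.
Proof.
move=> /subspace_continuousP/(_ r) cF /subspace_continuousP/(_ r) cG rab e0.
have {}cF : F @ within `[a, b] (nbhs r) --> F r by apply: cF; rewrite /= in_itv.
have {}cG : G @ within `[a, b] (nbhs r) --> G r by apply: cG; rewrite /= in_itv.
pose W := within `[a, b]%classic (nbhs r).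
have : (fun z => F z.1 * G z.2) @ filter_prod W W --> F r * G r.
  by apply: cvgM; [apply: cvg_comp cF; exact: cvg_fst|apply: cvg_comp cG; exact: cvg_snd].
move=> /cvgr_dist_le/(_ e e0)[[A B]/= [rA rB] AB].
have /nbhs_ballP[d1/= d10 h1] : nbhs r [set t | t \in `[a, b] -> A t] by [].
have /nbhs_ballP[d2/= d20 h2] : nbhs r [set t | t \in `[a, b] -> B t] by [].
near=> d => s t sab tab srd trd.
rewrite distrC; apply: (AB (t, s)); split => /=.
  apply: h1; last by rewrite in_itv.
  have : d < d1 by near: d; exact: nbhs_right_lt.
  by rewrite /ball/= ltr_norml; lra.
apply: h2; last by rewrite in_itv.
have : d < d2 by near: d; exact: nbhs_right_lt.
by rewrite /ball/= ltr_norml; lra.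
Unshelve. all: by end_near. Qed.

Section IncrementPrimitive.
Context {R : realType} {K : finType}.
Variables (a b : R) (A B C : K -> R -> R) (F : R -> R).
Hypotheses (contA : forall k, {within `[a, b], continuous (A k)})
  (contB : forall k, {within `[a, b], continuous (B k)})
  (intC : forall k, (leb R).-integrable `[a, b] (EFin \o C k))
  (incrF : forall s t, a <= s -> s <= t -> t <= b ->
     F t - F s = \sum_k A k t * B k s * \int[leb R]_(r in `]s, t]) C k r).

Let f r := \sum_k A k r * B k r * C k r.
Let c r := \sum_k `|C k r|.

Let integrable_sumR (h : K -> R -> R) (i : interval R) :
  (forall k, (leb R).-integrable [set` i] (EFin \o h k)) ->
  (leb R).-integrable [set` i] (EFin \o (fun r => \sum_k h k r)).
Proof.
move=> ih; have mi := measurable_lebR_itv i.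
have H := integrable_sum mi (index_enum K) (P := xpredT) (fun k _ => ih k).
by apply: (eq_integrable mi _ _ _ H) => r _ /=; rewrite sumEFin.
Qed.

Let intf : (leb R).-integrable `[a, b] (EFin \o f).
Proof.
apply: integrable_sumR => k.
have := integrable_continuousM (@contA k) (integrable_continuousM (@contB k) (intC k)).
by apply: eq_integrable_itv => r _ /=; rewrite mulrA.
Qed.

Let intc : (leb R).-integrable `[a, b] (EFin \o c).
Proof.
apply: integrable_sumR => k.
exact: integrable_norm (intC k).
Qed.

(** On a short interval around r the coefficients A(t) B(s) and A(w) B(w) both
    lie within e / 2 of A(r) B(r), so the error there is at most e times the
    integral of c.  This bound is additive in the interval, hence holds on
    every interval by [interval_induction]. *)
Let error_le e s t : 0 < e -> a <= s -> s <= t -> t <= b ->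
  `|F t - F s - \int[leb R]_(r in `]s, t]) f r| <= e * \int[leb R]_(r in `]s, t]) c r.
Proof.
move=> e0 sa st tb.
have sub x y : s <= x -> y <= t -> `]x, y] `<=` `[a, b].
  by move=> sx yt; apply: subset_itv; rewrite bnd_simp;
    [exact: le_trans sx|exact: le_trans tb].
apply: (interval_induction (P := fun s t =>
  `|F t - F s - \int[leb R]_(r in `]s, t]) f r| <=
    e * \int[leb R]_(r in `]s, t]) c r)) => //.
- move=> x y z sx xy yz zt Pxy Pyz.
  rewrite !(@Rintegral_itv_split _ (BRight x) y z)// ?bnd_simp//; last 2 first.
    exact: integrable_subitv (sub _ _ sx zt) intc.
    exact: integrable_subitv (sub _ _ sx zt) intf.
  rewrite mulrDr; apply: le_trans (lerD Pxy Pyz).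
  apply: le_trans (ler_normD _ _); rewrite [leLHS](_ : _ =
    `|(F y - F x - \int[leb R]_(r in `]x, y]) f r) +
      (F z - F y - \int[leb R]_(r in `]y, z]) f r)|)//.
  by congr `|_|; ring.
- move=> r /andP[sr rt].
  have e2 : 0 < e / 2 by lra.
  have rab : a <= r <= b by rewrite (le_trans sa sr) (le_trans rt tb).
  near=> d => x y sx rx xy yr yt.
  have xyab : `]x, y] `<=` `[a, b] := sub _ _ sx yt.
  have iC k : (leb R).-integrable `]x, y] (EFin \o C k).
    exact: integrable_subitv (intC k).
  have mxy := measurable_lebR_itv `]x, y].
  have icxy := integrable_subitv xyab intc.
  have ifxy := integrable_subitv xyab intf.
  have iS k : (leb R).-integrable `]x, y] (EFin \o (fun w => A k y * B k x * C k w)).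
    exact: (integrableZl mxy (A k y * B k x) (iC k)).
  have -> : F y - F x = \int[leb R]_(w in `]x, y]) \sum_k A k y * B k x * C k w.
    rewrite incrF ?(le_trans sa sx) ?(le_trans yt)//.
    rewrite /Rintegral; under eq_integral do rewrite -sumEFin.
    rewrite integral_sum// -sum_fine; last first.
      by move=> k _; apply: integrable_fin_num (iS k).
    by apply: eq_bigr => k _; exact: esym (RintegralZl _ mxy (iC k)).
  rewrite -RintegralB//; last exact: integrable_sumR.
  have idiff : (leb R).-integrable `]x, y]
      (EFin \o (fun w => \sum_k A k y * B k x * C k w - f w)).
    exact: (integrableB mxy (integrable_sumR iS) ifxy).
  apply: le_trans (le_normr_Rintegral mxy idiff) _.
  rewrite -RintegralZl//; apply: le_Rintegral => //.
  + exact: integrable_norm.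
  + exact: (integrableZl mxy e icxy).
  move=> w; rewrite /= in_itv/= => /andP[xw wy].
  rewrite /f -sumrB /c mulr_sumr.
  apply: le_trans (ler_norm_sum _ _ _) _; apply: ler_sum => k _.
  rewrite -mulrBl normrM ler_wpM2r//.
  have near_k : forall x y, a <= x <= b -> a <= y <= b -> r - d < x < r + d ->
      r - d < y < r + d -> `|A k y * B k x - A k r * B k r| <= e / 2.
    move: k {iC iS}; near: d; apply: filter_forall => k.
    exact: near_within_mul_le.
  have h1 : `|A k y * B k x - A k r * B k r| <= e / 2 by apply: near_k; lra.
  have h2 : `|A k w * B k w - A k r * B k r| <= e / 2 by apply: near_k; lra.
  rewrite [leLHS](_ : _ = `|(A k y * B k x - A k r * B k r)
     - (A k w * B k w - A k r * B k r)|); last by congr `|_|; ring.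
  by apply: le_trans (ler_normB _ _) _; lra.
Unshelve. all: by end_near. Qed.

(** This replaces integration by parts and the chain rule for absolutely
    continuous functions, avoiding both derivatives almost everywhere and
    double integrals. *)
Lemma increment_primitive :
  primitive_on a b F (fun r => \sum_k A k r * B k r * C k r).
Proof.
split=> // s t sa st tb; apply/eqP; rewrite -subr_eq0 -normr_le0.
set N := \int[leb R]_(r in `]s, t]) c r.
have N0 : 0 <= N by apply: Rintegral_ge0 => r _; apply: sumr_ge0.
apply/ler_addgt0Pr => e e0; rewrite add0r.
apply: le_trans (error_le (e := e / (N + 1)) _ sa st tb) _.
  by apply: divr_gt0 => //; lra.
by rewrite -/N -mulrA ler_piMr ?(ltW e0)// mulrC ler_pdivrMr; lra.
Qed.

End IncrementPrimitive.

(** * Matrix-valued indefinite integrals *)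

Section MatrixLimits.
Context {R : realType}.

Lemma cvg_big (T I : Type) (W : set_system T) {FW : Filter W} (l : seq I)
    (op : R -> R -> R) (idx : R) (h : I -> T -> R) (c : I -> R) :
  (forall F G x y, F @ W --> x -> G @ W --> y ->
     (fun t => op (F t) (G t)) @ W --> op x y) ->
  (forall i, h i @ W --> c i) ->
  (fun t => \big[op/idx]_(i <- l) h i t) @ W --> \big[op/idx]_(i <- l) c i.
Proof.
move=> opc hc; elim: l => [|i l ih].
  by under eq_fun do rewrite big_nil; rewrite big_nil; exact: cvg_cst.
by under eq_fun do rewrite big_cons; rewrite big_cons; exact: opc.
Qed.

Lemma cvg_det (T : Type) (W : set_system T) {FW : Filter W} n
    (M : T -> 'M[R]_n) (L : 'M[R]_n) :
  (forall i j, (fun t => M t i j) @ W --> L i j) -> (fun t => \det (M t)) @ W --> \det L.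
Proof.
move=> ML; apply: cvg_big => [F G x y|s]; first exact: cvgD.
apply: cvgM; first exact: cvg_cst.
by apply: cvg_big => // F G x y; exact: cvgM.
Qed.

(** Cramer's rule expresses the entries of the inverse through determinants. *)
Lemma cvg_invmx (T : Type) (W : set_system T) {FW : Filter W} n
    (M : T -> 'M[R]_n) (L : 'M[R]_n) :
  L \in unitmx -> (\forall t \near W, M t \in unitmx) ->
  (forall i j, (fun t => M t i j) @ W --> L i j) ->
  forall i j, (fun t => invmx (M t) i j) @ W --> invmx L i j.
Proof.
move=> Lu Mu ML i j.
apply: (@cvg_trans _ ((fun t => (\det (M t))^-1 * cofactor (M t) j i) @ W)).
  apply: near_eq_cvg.
  by near=> t; rewrite /invmx (near Mu t)// !mxE.
rewrite /invmx Lu !mxE; apply: cvgM.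
  by apply: cvgV; [rewrite -unitfE -unitmxE|exact: cvg_det].
apply: cvgM; first exact: cvg_cst.
apply: cvg_det => k l; rewrite !mxE; under eq_fun do rewrite !mxE.
exact: ML.
Unshelve. all: by end_near. Qed.

End MatrixLimits.

Section MatrixPrimitives.
Context {R : realType}.
Implicit Types a b : R.

Definition primitive_mx a b {p q} (M m : R -> 'M[R]_(p, q)) :=
  forall i j, primitive_on a b (fun t => M t i j) (fun t => m t i j).

Lemma primitive_mxB a b p q (M N m n : R -> 'M[R]_(p, q)) :
  primitive_mx a b M m -> primitive_mx a b N n ->
  primitive_mx a b (fun t => M t - N t) (fun t => m t - n t).
Proof.
move=> Mm Nn i j; have [im Mij] := Mm i j; have [i_n Nij] := Nn i j.
split.
  apply: eq_integrable_itv (integrableB (measurable_lebR_itv _) im i_n).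
  by move=> t _; rewrite !mxE.
move=> s t sa st tb.
under eq_Rintegral do rewrite !mxE.
have sub : `]s, t] `<=` `[a, b] by apply: subset_itv; rewrite bnd_simp.
rewrite RintegralB; [|exact: measurable_lebR_itv|exact: integrable_subitv im
  |exact: integrable_subitv i_n].
by rewrite -Mij// -Nij// !mxE; ring.
Qed.

Lemma primitive_mxT a b p q (M m : R -> 'M[R]_(p, q)) :
  primitive_mx a b M m -> primitive_mx a b (fun t => (M t)^T) (fun t => (m t)^T).
Proof.
move=> Mm i j; have [im Mji] := Mm j i; split.
  by apply: eq_integrable_itv im => t _; rewrite mxE.
move=> s t sa st tb; rewrite !mxE Mji//; apply: eq_Rintegral => r _.
by rewrite mxE.
Qed.

(** Entrywise, the increment of M N splits into terms
    N_kj(t) (M_ik(t) - M_ik(s)) and M_ik(s) (N_kj(t) - N_kj(s)), which have the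
    form required by [increment_primitive]. *)
Lemma primitive_mxM a b p q l (M m : R -> 'M[R]_(p, q)) (N n : R -> 'M[R]_(q, l)) :
  primitive_mx a b M m -> primitive_mx a b N n ->
  primitive_mx a b (fun t => M t *m N t) (fun t => m t *m N t + M t *m n t).
Proof.
move=> Mm Nn i j.
pose A (k : 'I_q + 'I_q) t := if k is inl k then N t k j else 1.
pose B (k : 'I_q + 'I_q) t := if k is inr k then M t i k else 1.
pose C (k : 'I_q + 'I_q) t := match k with inl k => m t i k | inr k => n t k j end.
apply: (@eq_primitive_on _ _ _ _ (fun t => \sum_k A k t * B k t * C k t)).
  move=> t _; rewrite big_sumType/= !mxE; congr (_ + _).
    by apply: eq_bigr => k _; rewrite mulr1 mulrC.
  by apply: eq_bigr => k _; rewrite mul1r.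
apply: increment_primitive.
- by case=> k; [exact: primitive_on_continuous (Nn k j)|move=> x; exact: cst_continuous].
- by case=> k; [move=> x; exact: cst_continuous|exact: primitive_on_continuous (Mm i k)].
- by case=> k; [exact: (Mm i k).1|exact: (Nn k j).1].
move=> s t sa st tb; rewrite big_sumType/= !mxE -sumrB -big_split/=.
apply: eq_bigr => k _; rewrite -(Mm i k).2// -(Nn k j).2//; ring.
Qed.

Lemma mulmx3E p q k l (A : 'M[R]_(p, q)) (X : 'M[R]_(q, k)) (B : 'M[R]_(k, l)) i j :
  (A *m X *m B) i j = \sum_(h : 'I_q * 'I_k) A i h.1 * B h.2 j * X h.1 h.2.
Proof.
rewrite -(pair_bigA _ (fun u v => A i u * B v j * X u v))/= exchange_big !mxE/=.
apply: eq_bigr => v _; rewrite !mxE mulr_suml; apply: eq_bigr => u _; ring.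
Qed.

(** M(t)^-1 - M(s)^-1 = - M(t)^-1 (M(t) - M(s)) M(s)^-1: each entry is a sum of
    increments of entries of M, with a factor taken at t and one taken at s. *)
Lemma primitive_invmx a b n (M m : R -> 'M[R]_n) :
  (forall t, a <= t <= b -> M t \in unitmx) ->
  primitive_mx a b M m ->
  primitive_mx a b (fun t => invmx (M t))
    (fun t => - (invmx (M t) *m m t *m invmx (M t))).
Proof.
move=> Mu Mm i j.
have contZ k l : {within `[a, b], continuous (fun t => invmx (M t) k l)}.
  apply/subspace_continuousP => t tab; apply: cvg_invmx.
  - by apply: Mu; move: tab; rewrite /= in_itv.
  - by rewrite near_withinE; near=> u; rewrite /= in_itv; exact: Mu.
  - move=> k' l'.
    by have /subspace_continuousP/(_ t tab) := primitive_on_continuous (Mm k' l').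
apply: (@eq_primitive_on _ _ _ _ (fun t => \sum_(h : 'I_n * 'I_n)
    (- invmx (M t) i h.1) * invmx (M t) h.2 j * m t h.1 h.2)).
  move=> t _; rewrite mxE mulmx3E -sumrN.
  by apply: eq_bigr => h _; ring.
apply: increment_primitive.
- by move=> h t; apply: cvgN; exact: contZ.
- by move=> h; exact: contZ.
- by move=> h; exact: (Mm _ _).1.
move=> s t sa st tb.
have Ms : M s \in unitmx by apply: Mu; rewrite sa (le_trans st).
have Mt : M t \in unitmx by apply: Mu; rewrite tb (le_trans sa).
have -> : invmx (M t) i j - invmx (M s) i j =
    - (invmx (M t) *m (M t - M s) *m invmx (M s)) i j.
  by rewrite mulmxBr mulmxBl mulVmx// mul1mx mulmxK// !mxE; ring.
rewrite mulmx3E -sumrN; apply: eq_bigr => h _.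
by rewrite -(Mm _ _).2// !mxE; ring.
Unshelve. all: by end_near. Qed.

End MatrixPrimitives.

(** * Gradients of an affine Hamiltonian *)

Section AffineGradient.
Context {R : realType} {k : nat}.
Implicit Types (v w x : 'cV[R]_k).

Lemma dotpE v w : dotp v w = (w^T *m v) 0 0.
Proof. by rewrite /dotp mxE; apply: eq_bigr => i _; rewrite mxE mulrC. Qed.

(** The difference quotients of h at x are constant near 0. *)
Lemma dotp_grad_affine (h : 'cV[R]_k -> R) (L : 'cV[R]_k -> R) (c : R) x w :
  (forall a v v', L (a *: v + v') = a * L v + L v') ->
  (\forall y \near x, h y = L y + c) -> dotp (grad h x) w = L w.
Proof.
move=> linL nearL.
have hx : h x = L x + c by exact: nbhs_singleton nearL.
have derL v : 'D_v h x = L v.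
  apply: cvg_lim => //.
  apply: (@cvg_trans _ ((fun=> L v) @ (0 : R)^')); last exact: cvg_cst.
  apply: near_eq_cvg.
  have shift0 : (fun e : R => e *: v + x) @ (0 : R)^' --> x.
    rewrite -[X in _ `=>` nbhs X]add0r -(scale0r v).
    apply: cvgD; last exact: cvg_cst.
    by apply: cvgZ; [exact: nbhs_dnbhs|exact: cvg_cst].
  have nearE : \forall e \near (0 : R)^', h (e *: v + x) = L (e *: v + x) + c.
    exact: shift0 nearL.
  near=> e.
  have e0 : e != 0 by near: e; exact: nbhs_dnbhs_neq.
  rewrite /= (near nearE e)// hx linL.
  rewrite (_ : e * L v + L x + c - (L x + c) = e * L v); last by ring.
  by rewrite scalerA mulVf// scale1r.
have L0 : L 0 = 0.
  by have := linL 1 0 0; rewrite scale1r addr0 mul1r; lra.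
have {2}-> : w = \sum_(j < k) w j 0 *: delta_mx j 0.
  by rewrite {1}[w]matrix_sum_delta; apply: eq_bigr => j _; rewrite big_ord1.
rewrite /dotp; elim/big_rec2 : _ => [//|j y z _ ->].
by rewrite linL mxE derL mulrC.
Unshelve. all: by end_near. Qed.

Lemma dotpBr v w w' :
  dotp v (w - w') = dotp v w - dotp v w'.
Proof. by rewrite /dotp -sumrB; apply: eq_bigr => i _; rewrite !mxE mulrBr. Qed.

Lemma eq_dotp v w : (forall x, dotp v x = dotp w x) -> v = w.
Proof.
move=> vw; apply/colP => i; have := vw (delta_mx i 0).
rewrite !dotpE trmx_delta -!rowE !mxE. exact.
Qed.

End AffineGradient.

Section AffinePartialGradients.
Context {R : realType} {n m : nat}.
Variables (L : {linear ('cV[R]_n * 'cV[R]_m)%type -> R^o}) (c : R).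
Variables (h : 'cV[R]_n -> 'cV[R]_m -> R) (x : 'cV[R]_n) (u : 'cV[R]_m).
Hypothesis affine_h : \forall z \near (x, u), h z.1 z.2 = L z + c.

Let linearL a z z' : L (a *: z + z') = a * L z + L z' :> R.
Proof. by rewrite linearP. Qed.

Lemma dotp_grad_affine_state w : dotp (grad (h^~ u) x) w = L (w, 0).
Proof.
apply: (@dotp_grad_affine _ _ _ (fun w => L (w, 0)) (L (0, u) + c)).
  by move=> a v v'; rewrite -linearL; congr (L _); congr pair; rewrite /= scaler0 addr0.
have cont : {for x, continuous (fun y : 'cV[R]_n => (y, u))}.
  apply: differentiable_continuous; exact: (@differentiable_pair _ _ _ _ id (cst u)).
have near_h : \forall y \near x, h y u = L (y, u) + c by exact: cont affine_h.
apply: filterS near_h => y ->.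
rewrite addrA -[L (y, 0) + _]linearD; congr (L _ + _).
by congr pair; rewrite /= ?addr0 ?add0r.
Qed.

Lemma dotp_grad_affine_control w : dotp (grad (h x) u) w = L (0, w).
Proof.
apply: (@dotp_grad_affine _ _ _ (fun w => L (0, w)) (L (x, 0) + c)).
  by move=> a v v'; rewrite -linearL; congr (L _); congr pair; rewrite /= scaler0 addr0.
have cont : {for u, continuous (fun v : 'cV[R]_m => (x, v))}.
  apply: differentiable_continuous; exact: (@differentiable_pair _ _ _ _ (cst x) id).
have near_h : \forall v \near u, h x v = L (x, v) + c by exact: cont affine_h.
apply: filterS near_h => v ->.
rewrite addrA -[L (0, v) + _]linearD; congr (L _ + _).
by congr pair; rewrite /= ?addr0 ?add0r.
Qed.

End AffinePartialGradients.

Section LinearHamiltonian.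
Context {R : realType} {n m : nat} (P : control_problem R n m).
Hypotheses (hP : standing_assumptions P) (hlin : linear_hamiltonian P).
Let f := dyn P.
Let g := gain P.

Lemma grad_state_hamiltonian t x u psi : 0 <= t -> stateset P x -> ctrlset P u ->
  grad (fun y => hamiltonian P y u t psi 1) x =
  grad (fun y => g y u t) x + (jac (fun y => f y u t) x)^T *m psi.
Proof.
case: hP => _ _ _ diff _ t0 Xx Uu; have [df dg] := diff t x u t0 Xx Uu.
have dpair : differentiable (fun y : 'cV[R]_n => (y, u)) x.
  exact: (@differentiable_pair _ _ _ _ id (cst u)).
have derg v : derivable (fun y => g y u t) x v.
  by apply: diff_derivable; exact: (differentiable_comp dpair dg).
have derf i v : derivable (fun y => f y u t i 0) x v.
  apply: diff_derivable.
  have := differentiable_comp dpair df.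
  move=> /differentiable_comp/(_ (differentiable_coord _ i 0)); exact.
apply/colP => j; rewrite !mxE.
rewrite (_ : (fun y => _) = (fun y => g y u t) +
    \sum_(i < n) (psi i 0 \*: (fun y => f y u t i 0))); last first.
  apply/funext => y; rewrite /hamiltonian mul1r /= fct_sumE.
  by congr (_ + _).
have derZ i : derivable (psi i 0 \*: (fun y => f y u t i 0)) x (delta_mx j 0).
  exact: derivableZ.
rewrite deriveD//; last exact: derivable_sum.
rewrite derive_sum//; congr (_ + _); apply: eq_bigr => i _.
by rewrite deriveZ// !mxE mulrC.
Qed.

(** An affine function has no second-order remainder, and its linear part is the
    same at (x, u) and (y, v); so the increment between these points, however
    far apart, is given by the two partial gradients at (x, u). *)
Lemma hamiltonian_increment t psi x u y v : 0 <= t ->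
  stateset P x -> ctrlset P u -> stateset P y -> ctrlset P v ->
  hamiltonian P y v t psi 1 - hamiltonian P x u t psi 1 =
  dotp (grad (fun w => g w u t) x + (jac (fun w => f w u t) x)^T *m psi) (y - x)
  + dotp (grad (fun w => hamiltonian P x w t psi 1) u) (v - u).
Proof.
move=> t0 Xx Uu Xy Uv; have [L [c Lc]] := hlin psi t0.
have Lxu := Lc x u Xx Uu.
rewrite -grad_state_hamiltonian//.
rewrite (dotp_grad_affine_state (h := fun y v => hamiltonian P y v t psi 1) Lxu).
rewrite (dotp_grad_affine_control (h := fun y v => hamiltonian P y v t psi 1) Lxu).
rewrite (nbhs_singleton (Lc y v Xy Uv)) (nbhs_singleton (Lc x u Xx Uu))/=.
rewrite -[RHS]linearD [(_ + _)%R in RHS](_ : _ = (y, v) - (x, u)); last first.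
  by congr pair; rewrite /= ?addr0 ?add0r.
by rewrite linearB /=; ring.
Qed.

(** For psi = 0 the Hamiltonian is the gain, which is therefore affine too.  This
    is what makes dg/dx integrable along the reference pair, where the control
    may be unbounded: the gradient can be read at a fixed state and control. *)
Lemma grad_gain_state_const t x u y v : 0 <= t ->
  stateset P x -> ctrlset P u -> stateset P y -> ctrlset P v ->
  grad (fun w => g w u t) x = grad (fun w => g w v t) y.
Proof.
move=> t0 Xx Uu Xy Uv; have [L [c Lc]] := hlin 0 t0.
have gE v' : (fun y => g y v' t) = (fun y => hamiltonian P y v' t 0 1).
  apply/funext => y'; rewrite /hamiltonian mul1r /dotp big1 ?addr0//.
  by move=> i _; rewrite mxE mul0r.
apply: eq_dotp => w.
pose h y v := hamiltonian P y v t 0 1.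
have Lxu := dotp_grad_affine_state (h := h) (Lc x u Xx Uu) w.
have Lyv := dotp_grad_affine_state (h := h) (Lc y v Xy Uv) w.
by rewrite !gE Lxu Lyv.
Qed.

End LinearHamiltonian.

(** * The first variation as a difference of gains *)

Section RegularData.
Context {R : realType} {n m : nat} (P : control_problem R n m).

Lemma regular_data_bounded h x u (a b : R) : regular_data P h ->
  stateset P x -> ctrlset P u -> 0 <= a -> a <= b ->
  [bounded h x u t | t in `[a, b]].
Proof.
move=> [locb _ _] Xx Uu a0 ab.
suff [M hM] : exists M, forall t, a <= t <= b -> `|h x u t| <= M.
  exists M; split; first exact: num_real.
  by move=> N /ltW MN t /=; rewrite in_itv/= => /hM /le_trans; exact.
apply: (interval_induction (P := fun s t =>
  exists M, forall r, s <= r <= t -> `|h x u r| <= M)) => //.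
  move=> r s t _ rs st _ [M hM] [N hN]; exists (Num.max M N) => w /andP[rw wt].
  rewrite le_max; have [ws|/ltW sw] := leP w s; first by rewrite hM// rw.
  by rewrite hN ?orbT// sw.
move=> r /andP[ar rb].
have /locb[M [_ /(_ (M + 1))]] : (stateset P `*` ctrlset P `*` `[0, +oo[) (x, u, r).
  by split => //=; rewrite in_itv/= andbT (le_trans a0).
have M1 : M < M + 1 by lra.
move=> /(_ M1); rewrite near_withinE => near_le.
have cont : {for r, continuous (fun t : R => (x, u, t))}.
  apply: differentiable_continuous.
  exact: (@differentiable_pair _ _ _ _ (cst (x, u)) id).
have : \forall t \near r, 0 <= t -> `|h x u t| <= M + 1.
  have near_rS : \forall t \near r,
      (stateset P `*` ctrlset P `*` `[0, +oo[) (x, u, t) -> `|h x u t| <= M + 1.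
    exact: cont near_le.
  apply: filterS near_rS => t + t0; apply.
  by split => //=; rewrite in_itv/= andbT.
move=> /nbhs_ballP[d1/= d10 near_le1].
apply: filterS (nbhs_right_lt d10) => d dd1 s t sa rs st tr tb.
exists (M + 1) => w /andP[sw wt]; apply: near_le1; last by lra.
by rewrite /ball/= ltr_norml; lra.
Qed.

Lemma regular_data_integrable h x u (a b : R) : regular_data P h ->
  stateset P x -> ctrlset P u -> 0 <= a -> a <= b ->
  (leb R).-integrable `[a, b] (EFin \o h x u).
Proof.
move=> reg Xx Uu a0 ab.
apply: measurable_bounded_integrable; first exact: measurable_lebR_itv.
- by rewrite [ltLHS](leb_itv `[a, b])/=; case: ifPn => // _; rewrite -EFinD ltry.
- have [_ mh _] := reg; apply: measurable_funS (mh x u Xx Uu).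
    exact: measurable_lebR_itv.
  by apply: subset_itv; rewrite bnd_simp.
exact: regular_data_bounded reg Xx Uu a0 ab.
Qed.

End RegularData.

Section FirstVariation.
Context {R : realType} {n m : nat} (P : control_problem R n m).
Variables (uh : R -> 'cV[R]_m) (xh : R -> 'cV[R]_n) (Y : R -> 'M[R]_n).
Hypotheses (hP : standing_assumptions P) (hlin : linear_hamiltonian P).
Hypotheses (hadm : admissible_pair P uh xh) (hY : fundamental_matrix P uh xh Y).

Let f := dyn P.
Let g := gain P.
Let t0 := initime P.
Let A t : 'M[R]_n := jac (fun y => f y (uh t) t) (xh t).
Let a t : 'cV[R]_n := grad (fun y => g y (uh t) t) (xh t).

Lemma caratheodory_primitive_mx p q (T : R) (y h : R -> 'M[R]_(p, q)) :
  caratheodory_solution t0 y h -> t0 <= T -> primitive_mx t0 T y h.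
Proof.
move=> sol t0T i j; have [inth yE] := sol i j.
apply: primitive_onP; first exact: inth.
by move=> t /andP[t0t _]; exact: yE.
Qed.

Lemma gain_gradient_integrable i T : t0 <= T ->
  (leb R).-integrable `[t0, T] (EFin \o (fun t => a t i 0)).
Proof.
move=> t0T; have [_ _ t0_ge0 _ [_ _ _ _ [reg _]]] := hP.
have [_ adm _ _ _] := hadm; have [Ut0 Xt0] := adm t0 (lexx _).
have := regular_data_integrable (reg i) Xt0 Ut0 t0_ge0 t0T.
apply: eq_integrable_itv => t; rewrite in_itv/= => /andP[t0t _].
have [Ut Xt] := adm t t0t.
have t_ge0 := le_trans t0_ge0 t0t.
by rewrite /a (grad_gain_state_const hlin t_ge0 Xt Ut Xt0 Ut0).
Qed.

(** The integrand is the difference of the gains minus the derivative q of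
    <psi, D>, and psi vanishes at T while D vanishes at t0. *)
Lemma first_variationE u x T : t0 <= T -> admissible_pair P u x ->
  first_variation P uh xh Y u T = J P uh xh T - J P u x T.
Proof.
move=> t0T [_ adm x0 solx intg].
have [_ admh xh0 solxh intgh] := hadm.
have [Yu solY] := hY.
have t0_ge0 : 0 <= t0 by have [] := hP.
pose Z t := invmx (Y t).
pose p t : 'cV[R]_n := \col_i \int[leb R]_(s in `[t, T]) (Y s *m a s) i 0.
pose psi t := Z t *m p t.
pose D t := x t - xh t.
pose F t := f (x t) (u t) t; pose Fh t := f (xh t) (uh t) t.
have DP : primitive_mx t0 T D (fun t => F t - Fh t).
  by apply: primitive_mxB; exact: caratheodory_primitive_mx.
have YP : primitive_mx t0 T Y (fun t => Y t *m (A t)^T).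
  exact: caratheodory_primitive_mx.
have ZP := primitive_invmx (fun t tT => Yu t (andP tT).1) YP.
have intYa i : (leb R).-integrable `[t0, T] (EFin \o (fun t => (Y t *m a t) i 0)).
  have mT := measurable_lebR_itv `[t0, T].
  have intS k : (leb R).-integrable `[t0, T] (EFin \o (fun t => Y t i k * a t k 0)).
    apply: integrable_continuousM; first exact: primitive_on_continuous (YP i k).
    exact: gain_gradient_integrable.
  have H := integrable_sum mT (index_enum 'I_n) (P := xpredT) (fun k _ => intS k).
  by apply: (eq_integrable mT _ _ _ H) => r _ /=; rewrite sumEFin mxE.
have pP : primitive_mx t0 T p (fun t => - (Y t *m a t)).
  move=> i j; rewrite ord1 {j}.
  have := primitive_on_tail (intYa i).
  have -> : (fun t => p t i 0) = (fun r => \int[leb R]_(w in `[r, T]) (Y w *m a w) i 0).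
    by apply/funext => t; rewrite /p mxE.
  by apply: eq_primitive_on => t _; rewrite mxE.
have QP := primitive_mxM (primitive_mxT DP) (primitive_mxM ZP pP).
(* q is the derivative of <psi, D>, after substituting the adjoint equation *)
pose q t := dotp (psi t) (F t - Fh t) - dotp (a t + (A t)^T *m psi t) (D t).
have {}QP : primitive_on t0 T (fun t => dotp (psi t) (D t)) q.
  have := QP 0 0.
  have -> : (fun t => ((D t)^T *m (invmx (Y t) *m p t)) 0 0) =
      (fun t => dotp (psi t) (D t)).
    by apply/funext => t; rewrite dotpE.
  apply: eq_primitive_on => t; rewrite in_itv/= => /andP[t0t _].
  have Yt := Yu t t0t.
  rewrite /q !dotpE -/(Z t) -/(psi t).
  rewrite (_ : - (Z t *m (Y t *m (A t)^T) *m Z t) *m p t + Z t *m - (Y t *m a t) =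
    - (a t + (A t)^T *m psi t)).
    by rewrite mulmxN !mxE.
  by rewrite mulNmx mulmxN /psi !mulmxA mulVmx// !mul1mx -opprD addrC.
have intq := QP.1.
have q0 : \int[leb R]_(t in `[t0, T]) q t = 0.
  rewrite Rintegral_itv_cc_oc// -QP.2//.
  have pT : p T = 0.
    apply/colP => i; rewrite !mxE Rintegral_itv_cc_oc//.
      by rewrite set_itv_ge ?Rintegral_set0// bnd_simp ltxx.
    by apply: integrable_subitv (intYa i); apply: subset_itvr; rewrite bnd_simp.
  have -> : D t0 = 0 by rewrite /D /t0 x0 xh0 subrr.
  by rewrite /psi pT !dotpE !mulmx0 trmx0 mul0mx !mxE subrr.
have G t : t0 <= t ->
    dotp (grad (fun v => hamiltonian P (xh t) v t (Jhat_x P uh xh Y t T) 1) (uh t))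
         (uh t - u t) = (g (xh t) (uh t) t - g (x t) (u t) t) - q t.
  move=> t0t; have t_ge0 := le_trans t0_ge0 t0t.
  have [Ut Xt] := adm t t0t; have [Uht Xht] := admh t t0t.
  have := hamiltonian_increment hP hlin (psi t) t_ge0 Xht Uht Xt Ut.
  rewrite /q -/(psi t) /hamiltonian !mul1r !dotpBr.
  rewrite -[Jhat_x P uh xh Y t T]/(psi t) /F /Fh -/f -/g; lra.
have -> : first_variation P uh xh Y u T =
    \int[leb R]_(t in `[t0, T]) ((g (xh t) (uh t) t - g (x t) (u t) t) - q t).
  by apply: eq_Rintegral => t; rewrite inE/= in_itv/= => /andP[/G ->].
have mT := measurable_lebR_itv `[t0, T].
rewrite RintegralB//; last exact: (integrableB mT (intgh T t0T) (intg T t0T)).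
by rewrite q0 subr0 RintegralB//; [exact: intgh|exact: intg].
Qed.

End FirstVariation.

(** * Signs of limits at infinity *)

Section LimitsAtInfinity.
Context {R : realType}.
Implicit Types phi : R -> R.

Lemma limf_einf_ge0 phi :
  (0 <= limf_einf (fun T => (phi T)%:E) (pinfty_nbhs R))%E <->
  forall e, 0 < e -> exists T, forall T', T <= T' -> - e <= phi T'.
Proof.
rewrite limf_einfE; split.
- move=> h e e0.
  have : (- e%:E < ereal_sup
      [set ereal_inf [set (phi x)%:E | x in V] | V in pinfty_nbhs R])%E.
    by apply: lt_le_trans h; rewrite lteNl oppe0 lte_fin.
  move=> /ereal_sup_gt[_ [V [M [_ MV]] <-] eV].
  exists (M + 1) => T' MT'.
  rewrite -lee_fin; apply: le_trans (ltW eV) _; apply: ereal_inf_lbound.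
  by exists T' => //; apply: MV; lra.
- move=> h; apply/lee_addgt0Pr => e e0; have [T hT] := h _ e0.
  rewrite -leeBlDr// sub0e.
  apply: (@le_trans _ _ (ereal_inf [set (phi x)%:E | x in [set t : R | T < t]])).
    apply: le_ereal_inf_tmp => _ [t /= Tt <-]; rewrite lee_fin; apply: hT; exact: ltW.
  apply: ereal_sup_ubound; exists [set t : R | T < t] => //.
  by exists T; split => //; exact: num_real.
Qed.

Lemma limf_esup_ge0 phi :
  (0 <= limf_esup (fun T => (phi T)%:E) (pinfty_nbhs R))%E <->
  forall e, 0 < e -> forall T, exists2 T', T <= T' & - e <= phi T'.
Proof.
rewrite limf_esupE; split.
- move=> /ereal_infP h e e0 T.
  have : (- e%:E < ereal_sup [set (phi x)%:E | x in [set t : R | (T < t)%R]])%E.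
    apply: (@lt_le_trans _ _ 0%E); first by rewrite lteNl oppe0 lte_fin.
    by apply: h; exists [set t : R | T < t] => //; exists T; split => //; exact: num_real.
  move=> /ereal_sup_gt[_ [t /= Tt <-]]; rewrite lte_fin => /ltW et.
  by exists t => //; exact: ltW.
- move=> h; apply/ereal_infP => _ [V [M [_ MV]] <-].
  apply/lee_addgt0Pr => e e0; have [T' MT' eT'] := h _ e0 (M + 1).
  rewrite -leeBlDr// sub0e.
  apply: (@le_trans _ _ (phi T')%:E); first by rewrite lee_fin.
  by apply: ereal_sup_ubound; exists T' => //; apply: MV; lra.
Qed.

End LimitsAtInfinity.

Theorem corollary1 (R : realType) (n m : nat) (P : control_problem R n m)
    (uh : R -> 'cV[R]_m) (xh : R -> 'cV[R]_n) (Y : R -> 'M[R]_n)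
    (hP : standing_assumptions P) (hlin : linear_hamiltonian P)
    (hadm : admissible_pair P uh xh) (hY : fundamental_matrix P uh xh Y) :
  (overtaking_optimal P uh xh <->
   forall u : R -> 'cV[R]_m, admissible_control P u ->
     (0 <= limf_einf (fun T : R => (first_variation P uh xh Y u T)%:E)
                     (pinfty_nbhs R))%E) /\
  (weakly_overtaking_optimal P uh xh <->
   forall u : R -> 'cV[R]_m, admissible_control P u ->
     (0 <= limf_esup (fun T : R => (first_variation P uh xh Y u T)%:E)
                     (pinfty_nbhs R))%E).
Proof.
have FV u x T : admissible_pair P u x -> initime P <= T ->
    first_variation P uh xh Y u T = J P uh xh T - J P u x T.
  by move=> ux t0T; exact: first_variationE.
split; split.
- move=> [_ opt] u [x ux]; apply/limf_einf_ge0 => e e0.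
  have [T t0T JT] := opt u x ux e e0.
  exists T => T' TT'; rewrite (FV u x)//; last by lra.
  by have := JT T' TT'; lra.
- move=> lim; split=> // u x ux e e0.
  have /limf_einf_ge0/(_ e e0)[T FVT] := lim u (ex_intro _ x ux).
  (* the threshold has to exceed t0, where the first variation is known *)
  exists (Num.max T (initime P + 1)); first by rewrite lt_max; apply/orP; right; lra.
  move=> T'; rewrite ge_max => /andP[TT' t0T'].
  by have := FVT T' TT'; rewrite (FV u x)//; lra.
- move=> [_ opt] u [x ux]; apply/limf_esup_ge0 => e e0 T.
  have [|T' TT' JT'] := opt u x ux e e0 (Num.max T (initime P + 1)).
    by rewrite lt_max; apply/orP; right; lra.
  move: TT'; rewrite ge_max => /andP[TT' t0T'].
  by exists T' => //; rewrite (FV u x)//; lra.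
- move=> lim; split=> // u x ux e e0 T t0T.
  have /limf_esup_ge0/(_ e e0 T)[T' TT' FVT'] := lim u (ex_intro _ x ux).
  by exists T' => //; move: FVT'; rewrite (FV u x)//; lra.
Qed.
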